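(* Let $\bar x\in\mathbb R^n$, $\bar y\in\mathcal F(\bar x)$ and let $u\in\mathbb R^n$ be a given direction. Suppose that for every $d\in\mathrm{Im}D_xP(\bar x,\bar y;u)$ and every sequence $\tau_k\downarrow0$ there exists $v\in\mathbb R^m$ such that $$\liminf_{k\to\infty}\frac{\mathrm{dist}\big(P(\bar x,\bar y)+\tau_k(d+\nabla_yP(\bar x,\bar y)v),\,C\big)}{\tau_k}=0,$$ and that for every $w\in D(\bar x,\bar y;u)$ $$\nabla_yP(\bar x,\bar y)^T\lambda=0,\quad\lambda\in N_C(P(\bar x,\bar y);w)\ \Longrightarrow\ \lambda=0 .$$ Then $\mathcal F$ satisfies Robinson stability (RS) at $(\bar x,\bar y)$ in direction $u$.
   Context: Setting: $P:\mathbb R^n\times\mathbb R^m\to\mathbb R^p$ is continuously differentiable, $C\subseteq\mathbb R^p$ is closed, and $\mathcal F(x):=\{y\in\mathbb R^m: P(x,y)\in C\}$. Image directional derivative: $\mathrm{Im}D_xP(\bar x,\bar y;u)$ is the closed cone $\{\alpha w:\alpha\ge0,\ \exists t_k\downarrow0,\ u^k\to u\text{ s.t. } w=\lim_k\frac{P(\bar x+t_ku^k,\bar y)-P(\bar x,\bar y)}{\|P(\bar x+t_ku^k,\bar y)-P(\bar x,\bar y)\|}\}$, with the convention that $0$ always belongs to it. $D(\bar x,\bar y;u):=\{d+\nabla_yP(\bar x,\bar y)v:\ 0\ne(d,v)\in\mathrm{Im}D_xP(\bar x,\bar y;u)\times\mathbb R^m,\ d+\nabla_yP(\bar x,\bar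 y)v\in T_C(P(\bar x,\bar y))\}$, where $T_C(\bar z):=\{d:\exists t_k\downarrow0,\ d_k\to d,\ \bar z+t_kd_k\in C\}$ is the contingent cone. Directional limiting normal cone: $N_C(\bar z;w):=\{\zeta:\exists t_k\downarrow0,\ w_k\to w,\ \zeta_k\to\zeta,\ \zeta_k\in\widehat N_C(\bar z+t_kw_k)\}$, where $\widehat N_C(z):=\{\zeta:\langle\zeta,z'-z\rangle\le o(\|z'-z\|)\ \forall z'\in C\}$ for $z\in C$ and $\widehat N_C(z)=\emptyset$ for $z\notin C$. Directional neighborhood: for $\varepsilon,\delta>0$, $\mathcal V_{\varepsilon,\delta}(d):=\{0\}\cup\{z\in\varepsilon\mathbb B\setminus\{0\}:\|z/\|z\|-d/\|d\|\|\le\delta\}$ if $d\ne0$, and $\mathcal V_{\varepsilon,\delta}(0):=\varepsilon\mathbb B$, where $\mathbb B$ is the open unit ball. Robinson stability (RS) of $\mathcal F$ at $(\bar x,\bar y)$ in direction $u$: there are $\kappa\ge0$, $\varepsilon,\delta>0$ with $\mathrm{dist}(y,\mathcal F(x))\le\kappa\,\mathrm{dist}(P(x,y),C)$ for all $(x,y)\in(\bar x,\bar y)+\mathcal V_{\varepsilon,\delta}(u)\times\varepsilon\mathbb B$. *)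

(* Defs.v *)
From HB Require Import structures.
From mathcomp Require Import all_boot all_order all_algebra.
From mathcomp Require Import all_classical all_reals all_analysis.
Set Implicit Arguments.
Unset Strict Implicit.
Unset Printing Implicit Defensive.
Import Order.TTheory GRing.Theory Num.Theory.
Import numFieldNormedType.Exports.
Local Open Scope classical_set_scope.
Local Open Scope ring_scope.

(* Vectors are rows: with J := 'J f y, the derivative of f at y sends v to
   v *m J, and its transpose sends lambda to lambda *m J^T.
   The library norm `|_| on 'rV[R]_n is the sup norm.  It induces the usual
   topology, so it serves for limits, closedness and differentiability; every
   norm or distance written below is the Euclidean one. *)

Definition dotv (R : realType) (n : nat) (a b : 'rV[R]_n) : R :=
  \sum_(i < n) a 0 i * b 0 i.

Definition enorm (R : realType) (n : nat) (a : 'rV[R]_n) : R :=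
  Num.sqrt (dotv a a).

Definition normalize (R : realType) (n : nat) (a : 'rV[R]_n) : 'rV[R]_n :=
  (enorm a)^-1 *: a.

(* Extended-real valued, so that the distance to the empty set is +oo. *)
Definition set_dist (R : realType) (n : nat) (z : 'rV[R]_n) (A : set 'rV[R]_n)
    : \bar R :=
  ereal_inf [set (enorm (z - a))%:E | a in A].

(* t_k \downarrow 0: positive and convergent to 0, not necessarily monotone. *)
Definition downto0 (R : realType) (t : nat -> R) : Prop :=
  (forall k, 0 < t k) /\ t @ \oo --> (0 : R).

Definition continuously_differentiable (R : realType) (n m p : nat)
    (P : 'rV[R]_n -> 'rV[R]_m -> 'rV[R]_p) : Prop :=
  [/\ forall z : 'rV[R]_n * 'rV[R]_m,
        differentiable (fun z : 'rV[R]_n * 'rV[R]_m => P z.1 z.2) z,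
      continuous (fun z : 'rV[R]_n * 'rV[R]_m =>
        'J (fun x => P x z.2) z.1)
    & continuous (fun z : 'rV[R]_n * 'rV[R]_m => 'J (P z.1) z.2)].

Definition feasible (R : realType) (n m p : nat)
    (P : 'rV[R]_n -> 'rV[R]_m -> 'rV[R]_p) (C : set 'rV[R]_p)
    (x : 'rV[R]_n) : set 'rV[R]_m :=
  [set y | C (P x y)].

Definition ImD (R : realType) (n m p : nat)
    (P : 'rV[R]_n -> 'rV[R]_m -> 'rV[R]_p)
    (x : 'rV[R]_n) (y : 'rV[R]_m) (u : 'rV[R]_n) : set 'rV[R]_p :=
  [set d | d = 0 \/
    exists (alpha : R) (w : 'rV[R]_p) (t : nat -> R) (uk : nat -> 'rV[R]_n),
      [/\ 0 <= alpha, d = alpha *: w, downto0 t, uk @ \oo --> u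
        & (forall k, P (x + t k *: uk k) y - P x y != 0) /\
          (fun k => normalize (P (x + t k *: uk k) y - P x y)) @ \oo --> w]].

Definition contingent_cone (R : realType) (p : nat) (C : set 'rV[R]_p)
    (z : 'rV[R]_p) : set 'rV[R]_p :=
  [set d | exists (t : nat -> R) (dk : nat -> 'rV[R]_p),
    [/\ downto0 t, dk @ \oo --> d & forall k, C (z + t k *: dk k)]].

Definition dirD (R : realType) (n m p : nat)
    (P : 'rV[R]_n -> 'rV[R]_m -> 'rV[R]_p) (C : set 'rV[R]_p)
    (x : 'rV[R]_n) (y : 'rV[R]_m) (u : 'rV[R]_n) : set 'rV[R]_p :=
  [set w | exists (d : 'rV[R]_p) (v : 'rV[R]_m),
    [/\ (d, v) != 0, ImD P x y u d,
        contingent_cone C (P x y) (d + v *m 'J (P x) y)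
      & w = d + v *m 'J (P x) y]].

Definition frechet_normal (R : realType) (p : nat) (C : set 'rV[R]_p)
    (z : 'rV[R]_p) : set 'rV[R]_p :=
  [set zeta | C z /\
    forall e : R, 0 < e ->
      \forall z' \near z, C z' -> dotv zeta (z' - z) <= e * enorm (z' - z)].

Definition dir_limiting_normal (R : realType) (p : nat) (C : set 'rV[R]_p)
    (z w : 'rV[R]_p) : set 'rV[R]_p :=
  [set zeta | exists (t : nat -> R) (wk zetak : nat -> 'rV[R]_p),
    [/\ downto0 t, wk @ \oo --> w, zetak @ \oo --> zeta
      & forall k, frechet_normal C (z + t k *: wk k) (zetak k)]].

Definition dir_nbhd (R : realType) (n : nat) (eps delta : R) (d : 'rV[R]_n)
    : set 'rV[R]_n :=
  if d == 0 then [set z | enorm z < eps]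
  else [set 0] `|`
       [set z | [/\ enorm z < eps, z != 0
                  & enorm (normalize z - normalize d) <= delta]].

Definition Robinson_stable (R : realType) (n m p : nat)
    (P : 'rV[R]_n -> 'rV[R]_m -> 'rV[R]_p) (C : set 'rV[R]_p)
    (x0 : 'rV[R]_n) (y0 : 'rV[R]_m) (u : 'rV[R]_n) : Prop :=
  exists kappa eps delta : R,
    [/\ 0 <= kappa, 0 < eps, 0 < delta
      & forall (x : 'rV[R]_n) (y : 'rV[R]_m),
          dir_nbhd eps delta u (x - x0) -> enorm (y - y0) < eps ->
          (set_dist y (feasible P C x) <= kappa%:E * set_dist (P x y) C)%E].

(* Main.v *)
(* Suppose stability fails.  Minimising |P x y' - c'| + e |y' - y| over all y'
   and all c' in C, from a point that violates the error bound with constant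
   1/e, gives infeasible points y_k -> ybar with nearest points c_k in C such that
   y_k is e_k-stationary for the residual.  The unit vectors zeta_k pointing from
   c_k to P x_k y_k are Frechet normals to C at c_k, and stationarity gives
   zeta_k J_k^T -> 0.  With tau_k = |P x_k ybar - P xbar ybar| + |y_k - ybar|,
   pass to limits d of (P x_k ybar - P xbar ybar) / tau_k, v of
   (y_k - ybar) / tau_k and lambda of zeta_k; then (d, v) <> 0 and d lies in ImD.
   The first hypothesis supplies a competitor ybar + tau_k v' with residual
   o(tau_k), so stationarity makes the residual at y_k an o(tau_k) too.  Hence
   (c_k - P xbar ybar) / tau_k -> d + v J, and lambda is a unit directional
   limiting normal in that direction with lambda J^T = 0. *)

Require Import Defs.
From mathcomp Require Import all_boot all_order all_algebra.
From mathcomp Require Import all_classical all_reals all_analysis.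
From mathcomp Require Import ring lra.
Import Order.TTheory GRing.Theory Num.Theory.
Import numFieldNormedType.Exports.
Local Open Scope classical_set_scope.
Local Open Scope ring_scope.

Set Implicit Arguments.
Unset Strict Implicit.
Unset Printing Implicit Defensive.

(** * Euclidean inner product and norm on row vectors *)

Section Euclidean.
Variables (R : realType) (n : nat).
Implicit Types (a b c : 'rV[R]_n) (k : R).

Lemma dotvC a b : dotv a b = dotv b a.
Proof. by apply: eq_bigr => i _; rewrite mulrC. Qed.

Lemma dotvDl a b c : dotv (a + b) c = dotv a c + dotv b c.
Proof. by rewrite -big_split; apply: eq_bigr => i _; rewrite mxE mulrDl. Qed.

Lemma dotvZl k a b : dotv (k *: a) b = k * dotv a b.
Proof. by rewrite /dotv mulr_sumr; apply: eq_bigr => i _; rewrite mxE mulrA. Qed.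

Lemma dotvDr a b c : dotv a (b + c) = dotv a b + dotv a c.
Proof. by rewrite dotvC dotvDl !(dotvC a). Qed.

Lemma dotvZr k a b : dotv a (k *: b) = k * dotv a b.
Proof. by rewrite dotvC dotvZl dotvC. Qed.

Lemma dotvNl a b : dotv (- a) b = - dotv a b.
Proof. by rewrite -scaleN1r dotvZl mulN1r. Qed.

Lemma dotvNr a b : dotv a (- b) = - dotv a b.
Proof. by rewrite dotvC dotvNl dotvC. Qed.

Lemma dotv_ge0 a : 0 <= dotv a a.
Proof. by apply: sumr_ge0 => i _; rewrite -expr2 sqr_ge0. Qed.

Lemma enorm_ge0 a : 0 <= enorm a.
Proof. exact: sqrtr_ge0. Qed.

Lemma sqr_enorm a : enorm a ^+ 2 = dotv a a.
Proof. by rewrite sqr_sqrtr // dotv_ge0. Qed.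

Lemma enormZ k a : enorm (k *: a) = `|k| * enorm a.
Proof.
by rewrite /enorm dotvZl dotvZr mulrA -expr2 sqrtrM ?sqr_ge0 // sqrtr_sqr.
Qed.

Lemma enormN a : enorm (- a) = enorm a.
Proof. by rewrite -scaleN1r enormZ normrN1 mul1r. Qed.

Lemma enorm0 : enorm (0 : 'rV[R]_n) = 0.
Proof. by rewrite -(scale0r (0 : 'rV[R]_n)) enormZ normr0 mul0r. Qed.

Lemma enormBC a b : enorm (a - b) = enorm (b - a).
Proof. by rewrite -enormN opprB. Qed.

Lemma normr_le_enorm a : `|a| <= enorm a.
Proof.
rewrite [leLHS]/Num.norm /= mx_normrE; apply/bigmax_leP; split=> [|[i j] _ /=].
  exact: enorm_ge0.
rewrite -(@ler_pXn2r _ 2) ?nnegrE ?enorm_ge0 // sqr_enorm real_normK ?num_real //.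
rewrite /dotv (bigD1 j) //= ord1 -expr2 lerDl.
by apply: sumr_ge0 => k _; rewrite -expr2 sqr_ge0.
Qed.

(** Together with [normr_le_enorm] this makes the two norms equivalent, so limits taken in the sup
    norm pass to [enorm]. The constant n replaces the sharp sqrt n to avoid a root. *)
Lemma enorm_le_normr a : enorm a <= n%:R * `|a|.
Proof.
rewrite -(@ler_pXn2r _ 2) ?nnegrE ?enorm_ge0 // ?mulr_ge0 // sqr_enorm exprMn.
have coor i : a 0 i * a 0 i <= `|a| ^+ 2.
  rewrite -expr2 -(real_normK (num_real (a 0 i))) lerXn2r ?nnegrE //.
  by rewrite [leRHS]/Num.norm /= mx_normrE; apply/bigmax_geP; right; exists (0, i).
apply: (le_trans (ler_sum _ (fun i _ => coor i))).
rewrite sumr_const card_ord -[leLHS]mulr_natl -natrX ler_wpM2r ?sqr_ge0 // ler_nat.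
by rewrite -mulnn; case: (n) => // l; rewrite leq_pmull.
Qed.

Lemma enorm_eq0 a : (enorm a == 0) = (a == 0).
Proof.
apply/eqP/eqP => [a0|->]; last exact: enorm0.
by apply/eqP; rewrite -normr_eq0 eq_le normr_ge0 -a0 normr_le_enorm.
Qed.

Lemma enorm_gt0 a : (0 < enorm a) = (a != 0).
Proof. by rewrite lt_def enorm_eq0 enorm_ge0 andbT. Qed.

(** Cauchy-Schwarz: expand the nonnegative square of | |b| a - |a| b | and divide by |a| |b|; the
    cases where that product vanishes are split off first. *)
Lemma dotv_le_enorm a b : dotv a b <= enorm a * enorm b.
Proof.
have [/eqP|a0] := eqVneq (enorm a) 0.
  rewrite enorm_eq0 => /eqP ->; rewrite -(scale0r (0 : 'rV[R]_n)) dotvZl mul0r.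
  by rewrite mulr_ge0 ?enorm_ge0.
have [/eqP|b0] := eqVneq (enorm b) 0.
  rewrite enorm_eq0 => /eqP ->; rewrite -(scale0r (0 : 'rV[R]_n)) dotvZr mul0r.
  by rewrite mulr_ge0 ?enorm_ge0.
have ab0 : 0 < enorm a * enorm b by rewrite mulr_gt0 // lt_def ?a0 ?b0 enorm_ge0.
have := dotv_ge0 (enorm b *: a - enorm a *: b).
rewrite !(dotvDl, dotvDr, dotvNl, dotvNr, dotvZl, dotvZr) -!sqr_enorm (dotvC b a).
by nra.
Qed.

Lemma enormD a b : enorm (a + b) <= enorm a + enorm b.
Proof.
rewrite -(@ler_pXn2r _ 2) ?nnegrE ?addr_ge0 ?enorm_ge0 // sqr_enorm.
rewrite !(dotvDl, dotvDr) -!sqr_enorm (dotvC b a).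
by have := dotv_le_enorm a b; nra.
Qed.

(* AM-GM: |a + b| <= (|a|^2 + |a + b|^2) / (2 |a|). *)
Lemma enormD_le_dotv a b : a != 0 ->
  enorm (a + b) <= enorm a + dotv (normalize a) b + enorm b ^+ 2 / (2 * enorm a).
Proof.
rewrite -enorm_gt0 => a0; rewrite /normalize dotvZl.
rewrite -(ler_pM2l (_ : 0 < 2 * enorm a)) ?mulr_gt0 //.
have -> : 2 * enorm a * (enorm a + (enorm a)^-1 * dotv a b
    + enorm b ^+ 2 / (2 * enorm a)) =
    2 * enorm a ^+ 2 + 2 * dotv a b + enorm b ^+ 2 by field; rewrite gt_eqF.
have := sqr_enorm (a + b).
rewrite !(dotvDl, dotvDr) -!sqr_enorm (dotvC b a).
by have := sqr_ge0 (enorm (a + b) - enorm a); nra.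
Qed.

Lemma enorm_normalize a : a != 0 -> enorm (normalize a) = 1.
Proof.
rewrite -enorm_gt0 => a0.
by rewrite enormZ ger0_norm ?invr_ge0 ?enorm_ge0 // mulVf // gt_eqF.
Qed.

Lemma normalizeZ k a : 0 < k -> normalize (k *: a) = normalize a.
Proof.
move=> k0; rewrite /normalize enormZ gtr0_norm // scalerA invfM mulrAC mulVf ?gt_eqF //.
by rewrite mul1r.
Qed.

Lemma enorm_normalizeE a : enorm a *: normalize a = a.
Proof.
have [->|a0] := eqVneq a 0; first by rewrite enorm0 scale0r.
by rewrite scalerA divff ?scale1r // enorm_eq0.
Qed.

Lemma cvg_enorm {T : Type} (F : set_system T) {FF : Filter F}
    (f : T -> 'rV[R]_n) a :
  f x @[x --> F] --> a -> enorm (f x) @[x --> F] --> enorm a.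
Proof.
move=> fa; apply/cvgrPdist_lt => e e0.
(* Adding 1 keeps the divisor positive when [n] is 0. *)
have M0 : 0 < n%:R + 1 :> R by rewrite ltr_wpDl.
near=> x.
have ab : enorm (a - f x) < e.
  apply: le_lt_trans (enorm_le_normr _) _.
  apply: (@le_lt_trans _ _ ((n%:R + 1) * `|a - f x|)).
    by rewrite ler_wpM2r // lerDl.
  rewrite -ltr_pdivlMl // mulrC.
  near: x; apply: cvgr_dist_lt => //.
  by rewrite divr_gt0.
apply: le_lt_trans ab; rewrite ler_norml.
have := enormD (a - f x) (f x); have := enormD (f x - a) a.
by rewrite !subrK (enormBC (f x) a); lra.
Unshelve. all: by end_near. Qed.

Lemma cvg_normalize {T : Type} (F : set_system T) {FF : Filter F}
    (f : T -> 'rV[R]_n) a : a != 0 ->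
  f x @[x --> F] --> a -> normalize (f x) @[x --> F] --> normalize a.
Proof.
move=> a0 fa; apply: cvgZ => //.
by apply: cvgV; rewrite ?enorm_eq0 //; exact: cvg_enorm.
Qed.

End Euclidean.

(** * Transposes and entrywise limits of matrices *)

Lemma dotv_mulmx (R : realType) (n p : nat) (v : 'rV[R]_n) (w : 'rV[R]_p)
  (M : 'M[R]_(n, p)) : dotv w (v *m M) = dotv v (w *m M^T).
Proof.
rewrite /dotv.
under eq_bigr do rewrite mxE big_distrr /=.
under [RHS]eq_bigr do rewrite mxE big_distrr /=.
rewrite exchange_big /=; apply: eq_bigr => i _; apply: eq_bigr => j _.
by rewrite !mxE; ring.
Qed.

Section MatrixLimits.
Variable R : realType.

Lemma normr_coord_le m n (A : 'M[R]_(m, n)) i j : `|A i j| <= `|A|.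
Proof.
by rewrite [leRHS]/Num.norm /= mx_normrE; apply/bigmax_geP; right; exists (i, j).
Qed.

Lemma normr_mx_le m n (A : 'M[R]_(m, n)) (e : R) :
  0 <= e -> (forall i j, `|A i j| <= e) -> `|A| <= e.
Proof.
move=> e0 Ae; rewrite [leLHS]/Num.norm /= mx_normrE.
by apply/bigmax_leP; split=> // -[i j] _; exact: Ae.
Qed.

Lemma normr_mulmx m n p (A : 'M[R]_(m, n)) (B : 'M[R]_(n, p)) :
  `|A *m B| <= n%:R * (`|A| * `|B|).
Proof.
apply: normr_mx_le => [|i j]; first by rewrite !mulr_ge0.
rewrite mxE; apply: le_trans (ler_norm_sum _ _ _) _.
apply: (@le_trans _ _ (\sum_(k < n) `|A| * `|B|)).
  by apply: ler_sum => k _; rewrite normrM ler_pM // normr_coord_le.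
by rewrite sumr_const card_ord mulr_natl.
Qed.

Context {T : Type} (F : set_system T) {FF : Filter F}.

Lemma cvg_mx m n (f : T -> 'M[R]_(m, n)) (A : 'M[R]_(m, n)) :
  (forall i j, f x i j @[x --> F] --> A i j) -> f x @[x --> F] --> A.
Proof.
move=> fA; apply/cvgrPdist_le => e e0.
have : \forall x \near F, forall i j, `|A i j - f x i j| <= e.
  apply: filter_forall => i; apply: filter_forall => j.
  by apply: cvgr_dist_le (fA i j) _ _.
apply: filterS => x Ax; apply: normr_mx_le => [|i j]; first exact: ltW.
by rewrite !mxE.
Qed.

Lemma cvg_coord m n (f : T -> 'M[R]_(m, n)) (A : 'M[R]_(m, n)) i j :
  f x @[x --> F] --> A -> f x i j @[x --> F] --> A i j.
Proof. move=> fA.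
apply/cvgrPdist_le => e e0; near=> x.
have := normr_coord_le (A - f x) i j; rewrite !mxE => /le_trans; apply.
by near: x; apply: cvgr_dist_le fA _ _.
Unshelve. all: by end_near. Qed.

Lemma cvg_trmx m n (f : T -> 'M[R]_(m, n)) (A : 'M[R]_(m, n)) :
  f x @[x --> F] --> A -> (f x)^T @[x --> F] --> A^T.
Proof.
move=> fA; apply: cvg_mx => i j; rewrite mxE; under eq_cvg do rewrite mxE.
exact: cvg_coord.
Qed.

Lemma cvg_mulmx m n p (f : T -> 'M[R]_(m, n)) (g : T -> 'M[R]_(n, p))
    (A : 'M[R]_(m, n)) (B : 'M[R]_(n, p)) :
  f x @[x --> F] --> A -> g x @[x --> F] --> B ->
  f x *m g x @[x --> F] --> A *m B.
Proof.
move=> fA gB; apply: cvg_mx => i j; rewrite mxE; under eq_cvg do rewrite mxE.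
apply: cvg_big => [|k _]; last by apply: cvgM; exact: cvg_coord.
exact: add_continuous.
Qed.

Lemma cvg_dotv n (a : 'rV[R]_n) (f : T -> 'rV[R]_n) (b : 'rV[R]_n) :
  f x @[x --> F] --> b -> dotv a (f x) @[x --> F] --> dotv a b.
Proof.
move=> fb; apply: cvg_big => [|i _]; first exact: add_continuous.
by apply: cvgMr; exact: cvg_coord.
Qed.

End MatrixLimits.

(** * Difference quotients, proximal normals and first-order optimality *)

Lemma near_enorm_lt (R : realType) (n : nat) (a : 'rV[R]_n) (e : R) :
  0 < e -> \forall b \near a, enorm (b - a) < e.
Proof.
move=> e0; have M0 : 0 < n%:R + 1 :> R by rewrite ltr_wpDl.
apply/nbhs_normP; exists (e / (n%:R + 1)); first exact: divr_gt0.
move=> b /=; rewrite distrC ltr_pdivlMr // mulrC; apply: le_lt_trans.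
by apply: le_trans (enorm_le_normr _) _; rewrite ler_wpM2r // lerDl.
Qed.

Lemma cvg_difference_quotient (R : realType) (m p : nat)
    (f : 'rV[R]_m -> 'rV[R]_p) (y h : 'rV[R]_m) : differentiable f y ->
  k^-1 *: (f (y + k *: h) - f y) @[k --> 0^'] --> h *m 'J f y.
Proof.
move=> df; rewrite -deriveEjacobian //.
under eq_cvg do rewrite (addrC y).
exact: diff_derivable.
Qed.

Lemma differentiable_partial (R : realType) (n m p : nat)
    (P : 'rV[R]_n -> 'rV[R]_m -> 'rV[R]_p) (x : 'rV[R]_n) (y : 'rV[R]_m) :
  differentiable (fun z : 'rV[R]_n * 'rV[R]_m => P z.1 z.2) (x, y) ->
  differentiable (P x) y.
Proof.
move=> dP; apply: (@differentiable_comp _ _ _ _ (fun y => (x, y))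
  (fun z : 'rV[R]_n * 'rV[R]_m => P z.1 z.2)) => //.
Qed.

(** Minimality of |z - c| combined with [enormD_le_dotv] bounds the pairing of the unit normal with
    z' - c by |z' - c|^2 / (2 |z - c|), which is o(|z' - c|). *)
Lemma nearest_point_frechet_normal (R : realType) (p : nat)
    (C : set 'rV[R]_p) (z c : 'rV[R]_p) : C c -> z != c ->
  (forall c', C c' -> enorm (z - c) <= enorm (z - c')) ->
  frechet_normal C c (normalize (z - c)).
Proof.
move=> Cc zc cmin; split=> // e e0.
have a0 : z - c != 0 by rewrite subr_eq0.
have na0 : 0 < enorm (z - c) by rewrite enorm_gt0.
(* Within the radius 2 e |z - c| the quadratic remainder is at most e |z' - c|. *)
have := near_enorm_lt c (mulr_gt0 e0 (mulr_gt0 (ltr0Sn _ 1) na0)).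
apply: filterS => z' z'c /cmin.
have := enormD_le_dotv (c - z') a0.
rewrite addrA subrK -(opprB z' c) dotvNr enormN.
have : enorm (z' - c) ^+ 2 / (2 * enorm (z - c)) <= e * enorm (z' - c).
  rewrite ler_pdivrMr ?mulr_gt0 // mulrAC expr2.
  by rewrite ler_wpM2r ?enorm_ge0 // ltW.
by lra.
Qed.

(* First-order optimality of y for |f - c| + e |. - y|, tested in the steepest
   descent direction - zeta J^T. *)
Lemma penalized_distance_stationary (R : realType) (m p : nat)
    (f : 'rV[R]_m -> 'rV[R]_p) (y : 'rV[R]_m) (c : 'rV[R]_p) (e : R) :
  0 <= e -> differentiable f y -> f y != c ->
  (forall y', enorm (f y - c) <= enorm (f y' - c) + e * enorm (y' - y)) ->
  enorm (normalize (f y - c) *m ('J f y)^T) <= e.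
Proof.
move=> e0 df fyc ymin; set a := f y - c; set g := normalize a *m _.
have a0 : a != 0 by rewrite subr_eq0.
have na0 : 0 < enorm a by rewrite enorm_gt0.
pose q k := k^-1 *: (f (y + k *: - g) - f y).
have qg : q k @[k --> 0^'+] --> - g *m 'J f y.
  exact/cvg_dnbhs_at_right/cvg_difference_quotient.
(* Dividing the bound of [enormD_le_dotv] by [k] leaves a factor [k] on the quadratic term, so only
   the linear term survives in the limit. *)
have lim : dotv (normalize a) (q k) + k * (enorm (q k) ^+ 2 / (2 * enorm a))
    @[k --> 0^'+] --> dotv (normalize a) (- g *m 'J f y) +
      0 * (enorm (- g *m 'J f y) ^+ 2 / (2 * enorm a)).
  apply: cvgD; first exact: cvg_dotv.
  apply: cvgM; first exact/cvg_at_right_filter/cvg_id.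
  by apply: cvgMl; apply: cvgM; exact: cvg_enorm.
have : - (e * enorm g) <= dotv (normalize a) (- g *m 'J f y).
  rewrite -[leRHS]addr0 -[X in _ + X](mul0r (enorm (- g *m 'J f y) ^+ 2 / (2 * enorm a))).
  apply: (cvgr_to_ge lim); near=> k.
  have k0 : 0 < k by [].
  have := ymin (y + k *: - g).
  have := enormD_le_dotv (f (y + k *: - g) - f y) a0.
  have -> : a + (f (y + k *: - g) - f y) = f (y + k *: - g) - c.
    by rewrite addrC addrA subrK.
  have -> : f (y + k *: - g) - f y = k *: q k.
    by rewrite scalerA divff ?gt_eqF // scale1r.
  rewrite (addrAC y) subrr add0r dotvZr (enormZ k (q k)) (enormZ k (- g)) enormN gtr0_norm // => h1 h2.
  rewrite -(ler_pM2l k0).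
  have -> : k * (dotv (normalize a) (q k) +
      k * (enorm (q k) ^+ 2 / (2 * enorm a))) =
    k * dotv (normalize a) (q k) + (k * enorm (q k)) ^+ 2 / (2 * enorm a).
    by field; rewrite gt_eqF.
  by move: h1 h2; rewrite -/a; lra.
(* Moving the Jacobian across the pairing turns it into -|g|^2, so |g|^2 <= e |g|. *)
rewrite dotv_mulmx -/g dotvNl -sqr_enorm => h.
have := enorm_ge0 g; rewrite le_eqVlt => /orP[/eqP <- //|g0].
by rewrite -(ler_pM2r g0) -expr2; lra.
Unshelve. all: by end_near. Qed.

(** The point of the bound is its uniformity in [x] near [x0]. Apply the mean value theorem to each
    coordinate on the segment from [y0] to [y], then use joint continuity of the partial Jacobian;
    the sup norm allows a different intermediate point for each coordinate. *)
Lemma partial_strict_differentiability (R : realType) (n m p : nat)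
    (P : 'rV[R]_n -> 'rV[R]_m -> 'rV[R]_p) (x0 : 'rV[R]_n) (y0 : 'rV[R]_m) (e : R) :
  continuously_differentiable P -> 0 < e ->
  exists2 d : R, 0 < d & forall x y, `|x - x0| < d -> `|y - y0| < d ->
    `|P x y - P x y0 - (y - y0) *m 'J (P x0) y0| <= e * `|y - y0|.
Proof.
move=> [dP _ cJ] e0.
(* The tolerance e / (m + 1) absorbs the factor m of [normr_mulmx]. *)
have M0 : 0 < m%:R + 1 :> R by rewrite ltr_wpDl.
have := cJ (x0, y0) => /cvgrPdist_lt /(_ _ (divr_gt0 e0 M0)) /=.
move=> /nbhs_ballP[d /= d0 Jd].
exists d => // x y xd yd; apply: normr_mx_le => [|i j]; first exact: mulr_ge0 (ltW _) _.
rewrite {i}(ord1 i).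
pose h := y - y0; pose g (s : R) : R := P x (y0 + s *: h) 0 j.
have dg (s : R) : is_derive s 1 g ((h *m 'J (P x) (y0 + s *: h)) 0 j).
  have dPx := differentiable_partial (dP (x, y0 + s *: h)).
  have := cvg_coord (i := 0) (j := j) (cvg_difference_quotient (h := h) dPx).
  have -> : (fun k => (k^-1 *: (P x (y0 + s *: h + k *: h) - P x (y0 + s *: h))) 0 j)
    = (fun k => k^-1 *: ((g \o shift s) (k *: 1) - g s)).
    apply/funext => k; rewrite !mxE /g /= /shift.
    by rewrite -addrA -scalerDl [s + k]addrC -[k *: 1]/(k * 1) mulr1.
  move=> /(_ (dnbhs_filter _)) gJ; split; first by apply: cvgP gJ.
  exact: cvg_lim gJ.
have [] := @MVT_segment R g (fun s => (h *m 'J (P x) (y0 + s *: h)) 0 j) 0 1 ler01.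
  apply: derivable_within_continuous => s _.
  by have [] := dg s.
move=> c; rewrite in_itv /= => /andP[c0 c1].
rewrite {1 2}/g scale0r addr0 scale1r subr0 mulr1 subrKC => gE.
have -> : (P x y - P x y0 - (y - y0) *m 'J (P x0) y0) 0 j =
   (h *m ('J (P x) (y0 + c *: h) - 'J (P x0) y0)) 0 j.
  by rewrite mulmxBr !mxE gE !mxE.
apply: le_trans (normr_coord_le _ _ _) _.
apply: le_trans (normr_mulmx _ _) _.
have : `|'J (P x) (y0 + c *: h) - 'J (P x0) y0| <= e / (m%:R + 1).
  rewrite distrC; apply: ltW; apply: (Jd (x, y0 + c *: h)).
  split=> /=; rewrite -ball_normE /= distrC //.
  rewrite addrAC subrr add0r normrZ; apply: le_lt_trans yd.
  by rewrite ler_piMl // ger0_norm.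
rewrite -/h => hJ.
rewrite mulrCA (mulrC e) ler_wpM2l //.
apply: (@le_trans _ _ ((m%:R + 1) * (e / (m%:R + 1)))).
  by apply: ler_pM => //; rewrite lerDl.
by rewrite mulrCA divff ?mulr1 // gt_eqF.
Qed.

(** * Distances to sets, lower limits and existence of penalized minimizers *)

Lemma set_dist_ltP (R : realType) (n : nat) (z : 'rV[R]_n) (A : set 'rV[R]_n)
    (r : \bar R) : (set_dist z A < r)%E -> exists2 a, A a & ((enorm (z - a))%:E < r)%E.
Proof. by move=> /ereal_inf_lt[_ [a Aa <-] ar]; exists a. Qed.

Lemma set_dist_le (R : realType) (n : nat) (z a : 'rV[R]_n) (A : set 'rV[R]_n) :
  A a -> (set_dist z A <= (enorm (z - a))%:E)%E.
Proof. by move=> Aa; apply: ereal_inf_lbound; exists a. Qed.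

(** A lower limit is the supremum of the tail infima, so the infimum of the tail from [N] is below
    [l] too. This provides arbitrarily late good indices. *)
Lemma limn_einf_lt (R : realType) (u : nat -> \bar R) (l : \bar R) (N : nat) :
  (limn_einf u < l)%E -> exists2 k, (N <= k)%N & (u k < l)%E.
Proof.
move=> ul; suff : (ereal_inf (sdrop u N) < l)%E.
  by move=> /ereal_inf_lt[_ [k /= Nk <-] ukl]; exists k.
apply: le_lt_trans ul; rewrite limn_einf_lim (cvg_lim _ (@cvg_einfs_sup _ u)) //.
by apply: ereal_sup_ubound; exists N.
Qed.

Lemma compact_closed_ball_rV (R : realType) (n : nat) (a : 'rV[R]_n) (r : R) :
  0 < r -> compact (closed_ball a r).
Proof.
move=> r0; apply: bounded_closed_compact; last exact: closed_ball_closed.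
exists (`|a| + r); split=> [|M rM b]; first exact: num_real.
rewrite closed_ballE // /closed_ball_ /= => abr.
apply: le_trans (ltW rM); rewrite -[b](subKr a).
by apply: le_trans (ler_normB _ _) _; rewrite lerD2l.
Qed.

(* The sublevel set is parametrised by (y, f y - c), which makes it compact
   without a bound on f. *)
Lemma penalized_distance_minimizer (R : realType) (m p : nat)
    (f : 'rV[R]_m -> 'rV[R]_p) (C : set 'rV[R]_p) (y0 : 'rV[R]_m)
    (c0 : 'rV[R]_p) (e : R) :
  continuous f -> closed C -> C c0 -> 0 < e ->
  exists y c, [/\ C c, enorm (f y - c) + e * enorm (y - y0) <= enorm (f y0 - c0)
    & forall y' c', C c' -> enorm (f y - c) + e * enorm (y - y0) <=
        enorm (f y' - c') + e * enorm (y' - y0)].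
Proof.
move=> cf clC Cc0 e0; set M := enorm (f y0 - c0).
have M0 : 0 <= M := enorm_ge0 _.
(* The sublevel set at [M] forces |y - y0| <= M / e and |r| <= M; the added 1 keeps both radii
   positive, so the closed balls have their usual description. *)
pose K := (closed_ball y0 (M / e + 1) `*` closed_ball (0 : 'rV[R]_p) (M + 1)) `&`
  [set z : 'rV[R]_m * 'rV[R]_p | C (f z.1 - z.2)].
pose g (z : 'rV[R]_m * 'rV[R]_p) := enorm z.2 + e * enorm (z.1 - y0).
have Me0 : 0 < M / e + 1 by rewrite ltr_wpDl // divr_ge0 // ltW.
have M10 : 0 < M + 1 by rewrite ltr_wpDl.
have inK y c : C c -> enorm (f y - c) + e * enorm (y - y0) <= M -> K (y, f y - c).
  move=> Cc le_M.
  split; last by rewrite /= subKr.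
  split; rewrite closed_ballE // /closed_ball_ /=.
    rewrite distrC; apply: le_trans (normr_le_enorm _) _.
    apply: (@le_trans _ _ (M / e)); last by rewrite lerDl.
    rewrite ler_pdivlMr // mulrC; apply: le_trans le_M.
    by rewrite lerDr enorm_ge0.
  rewrite sub0r normrN; apply: le_trans (normr_le_enorm _) _.
  have : 0 <= e * enorm (y - y0) by rewrite mulr_ge0 ?enorm_ge0 // ltW.
  by move: le_M; lra.
have le0 : enorm (f y0 - c0) + e * enorm (y0 - y0) <= M.
  by rewrite subrr enorm0 mulr0 addr0.
have cK : compact K.
  apply: compact_closedI; first by apply: compact_setX; apply: compact_closed_ball_rV.
  apply: (@preimage_closed _ _ (fun z : 'rV[R]_m * 'rV[R]_p => f z.1 - z.2)) => //.
  move=> z _; apply: cvgB; last exact: cvg_snd.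
  by apply: (@continuous_comp _ _ _ (@fst _ _) f z); [exact: cvg_fst|exact: cf].
have cg : continuous g.
  move=> z; apply: cvgD; first by apply: cvg_enorm; exact: cvg_snd.
  apply: cvgM; first exact: cvg_cst.
  apply: cvg_enorm; apply: cvgB; first exact: cvg_fst.
  exact: cvg_cst.
have K0 : K !=set0 by exists (y0, f y0 - c0); exact: inK.
have [[y r] /[!inE] -[_ /= Cr] gmin] := compact_EVT_min K0 cK (continuous_subspaceT cg).
have gE y' c' : C c' -> enorm (f y' - c') + e * enorm (y' - y0) <= M ->
    enorm r + e * enorm (y - y0) <= enorm (f y' - c') + e * enorm (y' - y0).
  by move=> Cc' /(inK _ _ Cc') ?; apply: (gmin (y', f y' - c')); rewrite inE.
have gM : enorm r + e * enorm (y - y0) <= M by apply: (le_trans _ le0); exact: gE.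
exists y, (f y - r); rewrite subKr; split=> // y' c' Cc'.
have [/(gE _ _ Cc') //|/ltW] := leP (enorm (f y' - c') + e * enorm (y' - y0)) M.
exact: le_trans.
Qed.

(** * Directional neighborhoods and the failure of stability *)

Lemma dir_nbhd_enorm_lt (R : realType) (n : nat) (e d : R) (u z : 'rV[R]_n) :
  0 < e -> dir_nbhd e d u z -> enorm z < e.
Proof.
by rewrite /dir_nbhd => e0; case: ifP => // _ [-> |[]//]; rewrite enorm0.
Qed.

Lemma dir_nbhd_le (R : realType) (n : nat) (e e' d : R) (u : 'rV[R]_n) :
  e <= e' -> dir_nbhd e d u `<=` dir_nbhd e' d u.
Proof.
rewrite /dir_nbhd => ee'; case: ifP => _ z /=; first by move=> /lt_le_trans; apply.
by move=> [->|[ze z0 zd]]; [left|right; split=> //; exact: lt_le_trans ee'].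
Qed.

Lemma continuous_pair_enorm (R : realType) (n m p : nat)
    (P : 'rV[R]_n -> 'rV[R]_m -> 'rV[R]_p) (x0 : 'rV[R]_n) (y0 : 'rV[R]_m) (e : R) :
  {for (x0, y0), continuous (fun z : 'rV[R]_n * 'rV[R]_m => P z.1 z.2)} -> 0 < e ->
  exists2 d : R, 0 < d & forall x y, enorm (x - x0) < d -> enorm (y - y0) < d ->
    enorm (P x y - P x0 y0) < e.
Proof.
move=> cP e0; have /cP /nbhs_ballP[d /= d0 Pd] := near_enorm_lt (P x0 y0) e0.
exists d => // x y xd yd; apply: (Pd (x, y)).
by split; rewrite -ball_normE /= distrC; apply: le_lt_trans (normr_le_enorm _) _.
Qed.

(** Violating the bound with constant 1/e makes every feasible point too far away: the minimizer
    [y1] pays e |y1 - y| <= |P x y - c1|, while reaching a feasible point would cost more, so the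
    residual at [y1] is nonzero. The triangle inequality then recenters the penalty from [y] to
    [y1]. *)
Lemma not_Robinson_stable_near_stationary (R : realType) (n m p : nat)
    (P : 'rV[R]_n -> 'rV[R]_m -> 'rV[R]_p) (C : set 'rV[R]_p)
    (x0 : 'rV[R]_n) (y0 : 'rV[R]_m) (u : 'rV[R]_n) (e : R) :
  continuously_differentiable P -> closed C ->
  feasible P C x0 y0 -> ~ Robinson_stable P C x0 y0 u -> 0 < e ->
  exists x y c, [/\ dir_nbhd e e u (x - x0), enorm (y - y0) < e, C c, P x y != c
    & forall y' c', C c' ->
        enorm (P x y - c) <= enorm (P x y' - c') + e * enorm (y' - y)].
Proof.
move=> [dP _ _] clC Cx0 nRS e0; apply: contrapT => none; apply: nRS.
(* A residual below e (e / 2) moves the minimizer by less than e / 2; the other e / 2 is left for |y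
   - y0|. *)
have e20 : 0 < e * (e / 2) by rewrite mulr_gt0 // divr_gt0.
have [d d0 Pd] := continuous_pair_enorm (differentiable_continuous (dP (x0, y0))) e20.
pose eps := Num.min d (e / 2).
have eps0 : 0 < eps by rewrite lt_min d0 divr_gt0.
have epse : eps <= e / 2 by rewrite ge_min lexx orbT.
exists e^-1, eps, e; split=> //; first by rewrite invr_ge0 ltW.
move=> x y xu ye; rewrite leNgt; apply/negP => far; apply: none.
have xd : enorm (x - x0) < d.
  by apply: lt_le_trans (dir_nbhd_enorm_lt eps0 xu) _; rewrite ge_min lexx.
have yd : enorm (y - y0) < d by apply: lt_le_trans ye _; rewrite ge_min lexx.
move: far; rewrite lte_pdivrMl // => /set_dist_ltP[c0 Cc0 c0far].
have nofeas y' : C (P x y') -> enorm (P x y - c0) < e * enorm (y - y').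
  move=> Cy'; rewrite -lte_fin; apply: lt_le_trans c0far _.
  by rewrite EFinM lee_pmul2l //; exact: set_dist_le.
(* Take the nearer of [c0] and [P x0 y0]: comparison with [c0] rules out a zero residual, comparison
   with [P x0 y0] controls the displacement. *)
have [c1 [Cc1 c1c0 c1z]] : exists c1, [/\ C c1,
    enorm (P x y - c1) <= enorm (P x y - c0)
    & enorm (P x y - c1) <= enorm (P x y - P x0 y0)].
  have [le|/ltW le] := leP (enorm (P x y - c0)) (enorm (P x y - P x0 y0)).
    by exists c0.
  by exists (P x0 y0).
have cPx : continuous (P x).
  by move=> y'; exact/differentiable_continuous/differentiable_partial.
have [y1 [c [Cc ylt ymin]]] := penalized_distance_minimizer y cPx clC Cc1 e0.
have ey1 : e * enorm (y1 - y) <= enorm (P x y - c1).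
  by apply: le_trans ylt; rewrite lerDr enorm_ge0.
exists x, y1, c; split=> //.
- by apply: dir_nbhd_le xu; lra.
- have : e * enorm (y1 - y) < e * (e / 2).
    by apply: le_lt_trans ey1 _; apply: le_lt_trans c1z _; exact: Pd.
  rewrite ltr_pM2l // => y1y; rewrite -(subrK y y1) -addrA.
  by apply: le_lt_trans (enormD _ _) _; lra.
- apply/eqP => Py1; have /nofeas : C (P x y1) by rewrite Py1.
  by rewrite (enormBC y y1) ltNge (le_trans ey1).
- move=> y' c' Cc'; have := ymin y' c' Cc'.
  have : e * enorm (y' - y) <= e * (enorm (y' - y1) + enorm (y1 - y)).
    by rewrite ler_pM2l // -{1}(subrK y1 y') -addrA enormD.
  by lra.
Qed.

(** * Subsequences and directional limits *)

(** [phi] need not be monotone: k <= phi k already carries limits along [phi], by [cvg_infty_ge]. *)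
Lemma compact_subsequence (R : realType) (V : normedModType R) (K : set V)
    (s : nat -> V) : compact K -> (forall k, K (s k)) ->
  exists (a : V), exists2 phi : nat -> nat, (forall k, (k <= phi k)%N) &
    s (phi k) @[k --> \oo] --> a.
Proof.
move=> cK Ks; have [] := cK (s @ \oo); first by exists 0%N => // k _; exact: Ks.
move=> a [_ sa]; exists a.
have /choice[phi phiP] k : exists l, (k <= l)%N /\ `|a - s l| < harmonic k.
  have [||b [[l /= kl <-]]] := sa (s @` [set l | (k <= l)%N]) (ball a (harmonic k)).
  - by exists k => // l /= kl; exists l.
  - by apply: nbhsx_ballx; rewrite /= invr_gt0.
  - by rewrite -ball_normE /= => al; exists l.
exists phi => [k|]; first by have [] := phiP k.
apply/cvgrPdist_lt => e e0; near=> k.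
have [_ /lt_trans] := phiP k; apply.
near: k.
have := @cvg_harmonic R => /cvgrPdist_lt /(_ _ e0); apply: filterS => k.
by rewrite sub0r normrN; apply: le_lt_trans; exact: ler_norm.
Unshelve. all: by end_near. Qed.

Lemma cvg_infty_ge (phi : nat -> nat) : (forall k, (k <= phi k)%N) ->
  phi k @[k --> \oo] --> \oo.
Proof.
by move=> phik A [N _ NA]; exists N => // k /= Nk; apply: NA; exact: leq_trans (phik k).
Qed.

(* cvg_pair over abstract normed modules: applied directly to matrices it
   unfolds their neighbourhood filters and loses the Filter instances. *)
Lemma cvg_pair_norm {T : Type} (F : set_system T) {FF : Filter F}
    (R : realType) (V W : normedModType R) (f : T -> V) (g : T -> W) (a : V) (b : W) :
  f x @[x --> F] --> a -> g x @[x --> F] --> b ->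
  (f x, g x) @[x --> F] --> (a, b).
Proof. exact: cvg_pair. Qed.

Lemma cvg_enorm_le {T : Type} (F : set_system T) {FF : Filter F}
    (R : realType) (n : nat) (f : T -> 'rV[R]_n) (a : 'rV[R]_n) (b : T -> R) :
  (forall x, enorm (f x - a) <= b x) -> b x @[x --> F] --> (0 : R) ->
  f x @[x --> F] --> a.
Proof.
move=> fb b0; apply/cvgrPdist_lt => e e0.
have : \forall x \near F, `|b x| < e by exact: cvgr0_norm_lt.
apply: filterS => x.
apply: le_lt_trans; rewrite distrC.
exact: le_trans (normr_le_enorm _) (le_trans (fb x) (ler_norm _)).
Qed.

Lemma cvg_pos_bounded {T : Type} (F : set_system T) {FF : Filter F}
    (R : realType) (a b : T -> R) :
  (forall x, 0 <= a x <= b x) -> b x @[x --> F] --> (0 : R) ->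
  a x @[x --> F] --> (0 : R).
Proof.
move=> ab b0; apply: (squeeze_cvgr _ (cvg_cst 0) b0).
exact: nearW.
Qed.

Lemma dir_nbhd_sequence (R : realType) (n : nat) (u : 'rV[R]_n)
    (e : nat -> R) (z : nat -> 'rV[R]_n) :
  downto0 e -> (forall k, dir_nbhd (e k) (e k) u (z k)) -> (forall k, z k != 0) ->
  exists (t : nat -> R) (uk : nat -> 'rV[R]_n),
    [/\ downto0 t, uk @ \oo --> u & forall k, z k = t k *: uk k].
Proof.
move=> [e0 cve] zu zn0; have ze k : enorm (z k) < e k by exact: dir_nbhd_enorm_lt (zu k).
have [u0|un0] := eqVneq u 0.
  (* For u = 0 only |z k| < e k is known; the step sqrt (e k) shares this smallness, since both it
     and |z k| / sqrt (e k) tend to 0. *)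
  have s0 k : 0 < Num.sqrt (e k) by rewrite sqrtr_gt0.
  have cvs : Num.sqrt (e k) @[k --> \oo] --> (0 : R).
    by rewrite -[X in _ --> X]sqrtr0; apply: (cvg_comp _ _ cve); exact: sqrt_continuous.
  exists (fun k => Num.sqrt (e k)), (fun k => (Num.sqrt (e k))^-1 *: z k); split=> //.
    rewrite u0; apply: (cvg_enorm_le (b := fun k => Num.sqrt (e k))) => // k.
    rewrite subr0 enormZ gtr0_norm ?invr_gt0 // ler_pdivrMl //.
    by rewrite -expr2 sqr_sqrtr ltW.
  by move=> k; rewrite scalerA divff ?scale1r // gt_eqF.
have nu0 : 0 < enorm u by rewrite enorm_gt0.
(* Rescaling z k to length |u| makes its distance to u at most |u| e k. *)
exists (fun k => enorm (z k) / enorm u), (fun k => enorm u *: normalize (z k)); split.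
- split=> [k|]; first by rewrite divr_gt0 // enorm_gt0.
  rewrite -[X in _ --> X](mul0r (enorm u)^-1); apply: cvgMl.
  apply: (cvg_pos_bounded _ cve) => k.
  by rewrite enorm_ge0 ltW.
- apply: (cvg_enorm_le (b := fun k => enorm u * e k)) => [k|].
    rewrite -{2}(enorm_normalizeE u) -scalerBr enormZ ger0_norm ?enorm_ge0 //.
    rewrite ler_wpM2l ?enorm_ge0 //.
    have := zu k; rewrite /dir_nbhd (negbTE un0) => -[z0|[]//].
    by have := zn0 k; rewrite z0 eqxx.
  by rewrite -[X in _ --> X](mulr0 (enorm u)); apply: cvgMr.
- by move=> k; rewrite scalerA mulfVK ?gt_eqF // enorm_normalizeE.
Qed.

(** Normalizing removes the positive factor 1 / tau k, so for d <> 0 the normalized increments tend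
    to d / |d|, and alpha = |d| recovers d. *)
Lemma ImD_cvg (R : realType) (n m p : nat)
    (P : 'rV[R]_n -> 'rV[R]_m -> 'rV[R]_p) (x0 : 'rV[R]_n) (y0 : 'rV[R]_m)
    (u : 'rV[R]_n) (e tau : nat -> R) (x : nat -> 'rV[R]_n) (d : 'rV[R]_p) :
  downto0 e -> (forall k, dir_nbhd (e k) (e k) u (x k - x0)) ->
  (forall k, 0 < tau k) ->
  (tau k)^-1 *: (P (x k) y0 - P x0 y0) @[k --> \oo] --> d ->
  ImD P x0 y0 u d.
Proof.
move=> [e0 cve] xu tau0 cvd; have [->|dn0] := eqVneq d 0; [by left|right].
(* [ImD] asks for nonzero increments at every index, but they are only eventually nonzero; hence the
   shift by [N]. *)
have [N _ NP] : \forall k \near \oo, P (x k) y0 - P x0 y0 != 0.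
  have d0 : 0 < `|d| by rewrite normr_gt0.
  have : \forall k \near \oo, 0 < `|(tau k)^-1 *: (P (x k) y0 - P x0 y0)|.
    by apply: cvgr_norm_gt d0.
  apply: filterS => k.
  by apply: contraTneq => ->; rewrite scaler0 normr0 ltxx.
have cvN : (k + N)%N @[k --> \oo] --> \oo.
  by apply: cvg_infty_ge => k; exact: leq_addr.
have PN k : P (x (k + N)%N) y0 - P x0 y0 != 0 by apply: NP; exact: leq_addl.
have [|k|k|t [uk [t0 ukE xE]]] := @dir_nbhd_sequence R n u
  (fun k => e (k + N)%N) (fun k => x (k + N)%N - x0).
- by split=> [k|]; [exact: e0|exact: (cvg_comp _ _ cvN cve)].
- exact: xu.
- by apply: contra_neq (PN k) => /subr0_eq ->; rewrite subrr.
have PE k : P (x0 + t k *: uk k) y0 - P x0 y0 = P (x (k + N)%N) y0 - P x0 y0.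
  by rewrite -xE subrKC.
exists (enorm d), (normalize d), t, uk; split=> //; first exact: enorm_ge0.
  by rewrite enorm_normalizeE.
split=> [k|]; first by rewrite PE.
have nE k : normalize (P (x0 + t k *: uk k) y0 - P x0 y0) =
    normalize ((tau (k + N)%N)^-1 *: (P (x (k + N)%N) y0 - P x0 y0)).
  by rewrite PE normalizeZ // invr_gt0.
under eq_cvg do rewrite nE.
by apply: cvg_normalize => //; exact: (cvg_comp _ _ cvN cvd).
Qed.

(** The base point [x k] moves, so differentiability of [P x0] alone is too weak; the uniform
    estimate of [partial_strict_differentiability] makes the remainder [r] vanish. *)
Lemma cvg_partial_quotient (R : realType) (n m p : nat)
    (P : 'rV[R]_n -> 'rV[R]_m -> 'rV[R]_p) (x0 : 'rV[R]_n) (y0 : 'rV[R]_m)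
    (tau : nat -> R) (x : nat -> 'rV[R]_n) (v : nat -> 'rV[R]_m) (v0 : 'rV[R]_m) :
  continuously_differentiable P -> downto0 tau -> x @ \oo --> x0 -> v @ \oo --> v0 ->
  (tau k)^-1 *: (P (x k) (y0 + tau k *: v k) - P (x k) y0) @[k --> \oo] -->
    v0 *m 'J (P x0) y0.
Proof.
move=> CP [tau0 cvtau] cvx cvv.
pose r k := (tau k)^-1 *: (P (x k) (y0 + tau k *: v k) - P (x k) y0) -
  v k *m 'J (P x0) y0.
suff r0 : r k @[k --> \oo] --> (0 : 'rV[R]_p).
  have rE k : (tau k)^-1 *: (P (x k) (y0 + tau k *: v k) - P (x k) y0) =
      r k + v k *m 'J (P x0) y0 by rewrite subrK.
  rewrite -[X in _ --> X]add0r.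
  under eq_cvg do rewrite rE.
  apply: cvgD => //.
  by apply: cvg_mulmx => //; exact: cvg_cst.
apply/cvgr0Pnorm_le => e e0.
have v1 : 0 < `|v0| + 1 by rewrite ltr_wpDl.
have [d d0 Pd] := partial_strict_differentiability x0 y0 CP (divr_gt0 e0 v1).
have cvtv : tau k *: v k @[k --> \oo] --> (0 : 'rV[R]_m).
  by rewrite -[X in _ --> X](scale0r v0); exact: cvgZ.
near=> k.
have xd : `|x k - x0| < d by near: k; exact: cvgr_distC_lt.
have vd : `|y0 + tau k *: v k - y0| < d.
  by rewrite addrAC subrr add0r; near: k; exact: cvgr0_norm_lt.
have vk : `|v k| < `|v0| + 1.
  by near: k; apply: cvgr_norm_lt cvv _ _; rewrite ltrDl.
have := Pd _ _ xd vd; rewrite (addrAC y0) subrr add0r.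
have -> : P (x k) (y0 + tau k *: v k) - P (x k) y0 - tau k *: v k *m 'J (P x0) y0 =
    tau k *: r k.
  by rewrite /r scalerBr scalerA divff ?gt_eqF // scale1r scalemxAl.
rewrite !normrZ gtr0_norm // mulrCA ler_pM2l // => /le_trans; apply.
by rewrite mulrAC ler_pdivrMr // ler_pM2l // ltW.
Unshelve. all: by end_near. Qed.

(* Testing near-stationarity with y0 + tau v', whose residual is o(tau), shows
   that the residual at y is o(tau) as well, so c and P x y have the same
   first-order behaviour. *)
Lemma near_stationary_direction (R : realType) (n m p : nat)
    (P : 'rV[R]_n -> 'rV[R]_m -> 'rV[R]_p) (C : set 'rV[R]_p)
    (x0 : 'rV[R]_n) (y0 : 'rV[R]_m) (e e' tau : nat -> R)
    (x : nat -> 'rV[R]_n) (y : nat -> 'rV[R]_m) (c c' : nat -> 'rV[R]_p)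
    (d : 'rV[R]_p) (v v' : 'rV[R]_m) :
  continuously_differentiable P -> downto0 tau ->
  e @ \oo --> (0 : R) -> e' @ \oo --> (0 : R) -> x @ \oo --> x0 ->
  (tau k)^-1 *: (P (x k) y0 - P x0 y0) @[k --> \oo] --> d ->
  (tau k)^-1 *: (y k - y0) @[k --> \oo] --> v ->
  (forall k, C (c' k)) ->
  (forall k, enorm (P x0 y0 + tau k *: (d + v' *m 'J (P x0) y0) - c' k)
     <= e' k * tau k) ->
  (forall k y' c', C c' -> enorm (P (x k) (y k) - c k) <=
     enorm (P (x k) y' - c') + e k * enorm (y' - y k)) ->
  (tau k)^-1 *: (c k - P x0 y0) @[k --> \oo] --> d + v *m 'J (P x0) y0.
Proof.
move=> CP t0 cve cve' cvx cvd cvv Cc' c'E stat; have [tau0 cvtau] := t0.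
pose q (w : nat -> 'rV[R]_m) k :=
  (tau k)^-1 *: (P (x k) (y0 + tau k *: w k) - P (x k) y0).
pose vk k := (tau k)^-1 *: (y k - y0).
pose dk k := (tau k)^-1 *: (P (x k) y0 - P x0 y0).
pose s k := (tau k)^-1 *: (P x0 y0 + tau k *: (d + v' *m 'J (P x0) y0) - c' k).
pose a k := (tau k)^-1 *: (P (x k) (y k) - c k).
have tK k (w : 'rV[R]_p) : tau k *: ((tau k)^-1 *: w) = w.
  by rewrite scalerA divff ?scale1r // gt_eqF.
have yE k : y k = y0 + tau k *: vk k.
  by rewrite scalerA divff ?gt_eqF // scale1r addrC subrK.
have cvs : s k @[k --> \oo] --> (0 : 'rV[R]_p).
  apply: (cvg_enorm_le _ cve') => k.
  by rewrite subr0 enormZ gtr0_norm ?invr_gt0 // ler_pdivrMl // mulrC.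
have cva : a k @[k --> \oo] --> (0 : 'rV[R]_p).
  (* The first norm telescopes to the competitor's residual divided by tau k, and the second term is
     its penalty divided by tau k. *)
  pose b k := enorm (dk k + q (fun=> v') k + s k - (d + v' *m 'J (P x0) y0)) +
    e k * enorm (v' - vk k).
  apply: (cvg_enorm_le (b := b)) => [k|].
    rewrite subr0 enormZ gtr0_norm ?invr_gt0 // ler_pdivrMl //.
    apply: le_trans (stat k (y0 + tau k *: v') (c' k) (Cc' k)) _.
    rewrite {1}yE opprD addrACA subrr add0r -scalerBr enormZ gtr0_norm //.
    rewrite [leRHS]mulrDr (mulrCA (tau k)) lerD2r -[X in X * _]gtr0_norm // -enormZ.
    rewrite scalerBr !scalerDr !tK -scalerDr le_eqVlt; apply/orP; left.
    move: (tau k *: (d + _)) => w; apply/eqP; congr enorm.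
    by apply/matrixP => i j; rewrite !mxE; ring.
  have -> : 0 = enorm (d + v' *m 'J (P x0) y0 + 0 - (d + v' *m 'J (P x0) y0)) +
      0 * enorm (v' - v) :> R.
    by rewrite addr0 subrr enorm0 mul0r addr0.
  apply: cvgD.
    apply: cvg_enorm; apply: cvgB; last exact: cvg_cst.
    apply: cvgD => //; apply: cvgD => //.
    by apply: cvg_partial_quotient => //; exact: cvg_cst.
  apply: cvgM => //; apply: cvg_enorm; apply: cvgB => //; exact: cvg_cst.
have wE k : (tau k)^-1 *: (c k - P x0 y0) = dk k + q vk k - a k.
  rewrite /q -yE -scalerDr -scalerBr; congr (_ *: _).
  by apply/matrixP => i j; rewrite !mxE; ring.
rewrite -[X in _ --> X]subr0.
under eq_cvg do rewrite wE.
apply: cvgB => //; apply: cvgD => //.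
exact: cvg_partial_quotient.
Qed.

(** * Passage to the limit and the contradiction *)

Theorem proposition3p3 (R : realType) (n m p : nat)
    (P : 'rV[R]_n -> 'rV[R]_m -> 'rV[R]_p) (C : set 'rV[R]_p)
    (hP : continuously_differentiable P) (hC : closed C)
    (xbar : 'rV[R]_n) (ybar : 'rV[R]_m) (hy : feasible P C xbar ybar)
    (u : 'rV[R]_n)
    (hliminf : forall d : 'rV[R]_p, ImD P xbar ybar u d ->
      forall tau : nat -> R, downto0 tau ->
      exists v : 'rV[R]_m,
        limn_einf (fun k =>
          (set_dist (P xbar ybar + tau k *: (d + v *m 'J (P xbar) ybar))%R C
            * ((tau k)^-1)%:E)%E) = 0%E)
    (hnormal : forall w : 'rV[R]_p, dirD P C xbar ybar u w ->
      forall lambda : 'rV[R]_p,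
        lambda *m ('J (P xbar) ybar)^T = 0 ->
        dir_limiting_normal C (P xbar ybar) w lambda ->
        lambda = 0) :
  Robinson_stable P C xbar ybar u.
Proof.
apply: contrapT => nRS; set J := 'J (P xbar) ybar; set z := P xbar ybar.
have [dP _ cJ] := hP.
have e0 k : 0 < harmonic k :> R by rewrite /= invr_gt0.
have cve : @harmonic R k @[k --> \oo] --> (0 : R) by exact: cvg_harmonic.
have /choice[s sP] k : exists s : 'rV[R]_n * 'rV[R]_m * 'rV[R]_p,
    [/\ dir_nbhd (harmonic k) (harmonic k) u (s.1.1 - xbar),
      enorm (s.1.2 - ybar) < harmonic k, C s.2, P s.1.1 s.1.2 != s.2
    & forall y' c', C c' -> enorm (P s.1.1 s.1.2 - s.2) <=
        enorm (P s.1.1 y' - c') + harmonic k * enorm (y' - s.1.2)].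
  have [x [y [c xyc]]] := not_Robinson_stable_near_stationary hP hC hy nRS (e0 k).
  by exists (x, y, c).
pose x k := (s k).1.1; pose y k := (s k).1.2; pose c k := (s k).2.
have xu k : dir_nbhd (harmonic k) (harmonic k) u (x k - xbar) by have [] := sP k.
have ye k : enorm (y k - ybar) < harmonic k by have [] := sP k.
have Cc k : C (c k) by have [] := sP k.
have Pc k : P (x k) (y k) != c k by have [] := sP k.
have stat k y' c' : C c' -> enorm (P (x k) (y k) - c k) <=
  enorm (P (x k) y' - c') + harmonic k * enorm (y' - y k) by have [_ _ _ _] := sP k; exact.
have cvx : x k @[k --> \oo] --> xbar.
  by apply: (cvg_enorm_le _ cve) => k; exact/ltW/(dir_nbhd_enorm_lt _ (xu k)).
have cvy : y k @[k --> \oo] --> ybar by apply: (cvg_enorm_le _ cve) => k; exact/ltW.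
(* Both increments are measured in the sup norm, so that |dk k| + |vk k| is exactly 1. *)
pose tau k := `|P (x k) ybar - z| + `|y k - ybar|.
have tau0 k : 0 < tau k.
  rewrite lt_def addr_ge0 // andbT paddr_eq0 // !normr_eq0 !subr_eq0.
  (* If tau k were 0, then P (x k) (y k) = z would lie in C, and testing [stat] with c' = z would
     give a zero residual. *)
  apply/negP => /andP[/eqP Pz /eqP yy]; have := stat k (y k) z hy.
  rewrite subrr enorm0 mulr0 addr0 yy Pz subrr enorm0 leNgt enorm_gt0 subr_eq0.
  by have := Pc k; rewrite yy Pz => ->.
have cvxybar : (x k, ybar) @[k --> \oo] --> (xbar, ybar).
  by apply: cvg_pair_norm => //; exact: cvg_cst.
have cvtau : tau k @[k --> \oo] --> (0 : R).
  have -> : 0 = `|z - z| + `|ybar - ybar| :> R by rewrite !subrr !normr0 addr0.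
  apply: cvgD; apply: cvg_norm; apply: cvgB => //; try exact: cvg_cst.
  exact: (cvg_comp _ _ cvxybar (differentiable_continuous (dP (xbar, ybar)))).
pose dk k := (tau k)^-1 *: (P (x k) ybar - z).
pose vk k := (tau k)^-1 *: (y k - ybar).
pose zk k := normalize (P (x k) (y k) - c k).
have dv1 k : `|dk k| + `|vk k| = 1.
  rewrite !normrZ normfV [X in X^-1]gtr0_norm // -mulrDr mulVf //.
  by rewrite gt_eqF.
have zk1 k : enorm (zk k) = 1 by rewrite enorm_normalize // subr_eq0.
pose K := closed_ball (0 : 'rV[R]_p) 1 `*` closed_ball (0 : 'rV[R]_m) 1 `*`
  closed_ball (0 : 'rV[R]_p) 1.
have cK : compact K.
  by apply: compact_setX; [apply: compact_setX|]; exact: compact_closed_ball_rV.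
have [|[[d v] lam] [phi phik cvphi]] := @compact_subsequence R _ _
    (fun k => (dk k, vk k, zk k)) cK.
  move=> k; split; [split|]; rewrite /= closed_ballE // /closed_ball_ /= sub0r normrN.
  - by rewrite -(dv1 k) lerDl.
  - by rewrite -(dv1 k) lerDr.
  - by rewrite -(zk1 k) normr_le_enorm.
have cvi := cvg_infty_ge phik.
have cvd : dk (phi k) @[k --> \oo] --> d.
  exact: (cvg_comp _ _ (cvg_comp _ _ cvphi (@cvg_fst _ _ _ _ _)) (@cvg_fst _ _ _ _ _)).
have cvv : vk (phi k) @[k --> \oo] --> v.
  exact: (cvg_comp _ _ (cvg_comp _ _ cvphi (@cvg_fst _ _ _ _ _)) (@cvg_snd _ _ _ _ _)).
have cvz : zk (phi k) @[k --> \oo] --> lam.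
  exact: (cvg_comp _ _ cvphi (@cvg_snd _ _ _ _ _)).
have dIm : ImD P xbar ybar u d.
  apply: (@ImD_cvg _ _ _ _ P xbar ybar u (harmonic \o phi) (tau \o phi) (x \o phi)) => //.
  - by split=> [k|]; [exact: e0|exact: (cvg_comp _ _ cvi cve)].
  - by move=> k; exact: xu.
  - by move=> k; exact: tau0.
have tphi0 : downto0 (tau \o phi).
  by split=> [k|]; [exact: tau0|exact: (cvg_comp _ _ cvi cvtau)].
have [v' liminf0] := hliminf d dIm _ tphi0.
(* A zero lower limit gives small residuals only along a further subsequence, here [psi]. The
   distance need not be attained, so a point of C within harmonic k * tau is chosen. *)
have /choice[g gP] k : exists g : nat * 'rV[R]_p, [/\ (k <= g.1)%N, C g.2 &
    enorm (z + tau (phi g.1) *: (d + v' *m J) - g.2) <= harmonic k * tau (phi g.1)].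
  have : (0 < (harmonic k)%:E :> \bar R)%E by rewrite lte_fin.
  rewrite -liminf0 => /(limn_einf_lt k)[l kl].
  rewrite lte_pdivrMr ?tau0 // -EFinM => /set_dist_ltP[c' Cc' c'E].
  by exists (l, c'); split=> //; apply: ltW; rewrite -lte_fin.
pose psi k := (g k).1; pose chi k := phi (psi k).
have cvpsi : psi k @[k --> \oo] --> \oo by apply: cvg_infty_ge => k; have [] := gP k.
have cvchi : chi k @[k --> \oo] --> \oo := cvg_comp _ _ cvpsi cvi.
have tchi0 : downto0 (tau \o chi).
  by split=> [k|]; [exact: tau0|exact: (cvg_comp _ _ cvchi cvtau)].
have cvdchi := cvg_comp _ _ cvpsi cvd.
have cvvchi := cvg_comp _ _ cvpsi cvv.
have cvw : (tau (chi k))^-1 *: (c (chi k) - z) @[k --> \oo] --> d + v *m J.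
  apply: (@near_stationary_direction R n m p P C xbar ybar (harmonic \o chi) harmonic
    (tau \o chi) (x \o chi) (y \o chi) (c \o chi) (fun k => (g k).2) d v v') => //.
  - exact: (cvg_comp _ _ cvchi cve).
  - exact: (cvg_comp _ _ cvchi cvx).
  - by move=> k; have [] := gP k.
  - by move=> k; have [] := gP k.
  - by move=> k; exact: stat.
have cE k : z + tau (chi k) *: ((tau (chi k))^-1 *: (c (chi k) - z)) = c (chi k).
  by rewrite scalerA divff ?gt_eqF // scale1r subrKC.
have wD : dirD P C xbar ybar u (d + v *m J).
  have dv : `|d| + `|v| = 1.
    have cvdv : `|dk (phi k)| + `|vk (phi k)| @[k --> \oo] --> `|d| + `|v|.
      by apply: cvgD; exact: cvg_norm.
    apply: (cvg_unique (@Rhausdorff R) cvdv); rewrite /=.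
    by under eq_cvg do rewrite dv1; exact: cvg_cst.
  exists d, v; split=> //.
    apply/eqP => -[d0 v0]; move/eqP: dv.
    by rewrite d0 v0 !normr0 addr0 eq_sym oner_eq0.
  (* The points [c (chi k)] of C realize this tangent direction. *)
  exists (tau \o chi), (fun k => (tau (chi k))^-1 *: (c (chi k) - z)); split=> // k.
  by rewrite /= cE.
have lamJ : lam *m J^T = 0.
  have cvJ : 'J (P (x k)) (y k) @[k --> \oo] --> J.
    exact: (cvg_comp _ _ (cvg_pair_norm cvx cvy) (cJ (xbar, ybar))).
  have cvl : zk (phi k) *m ('J (P (x (phi k))) (y (phi k)))^T @[k --> \oo] --> lam *m J^T.
    by apply: cvg_mulmx => //; apply: cvg_trmx; exact: (cvg_comp _ _ cvi cvJ).
  (* Stationarity with the point of C frozen at [c] bounds these products by the harmonic sequence,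
     so they also tend to 0. *)
  apply: (cvg_unique (@norm_hausdorff _ _) cvl); rewrite /=.
  apply: (cvg_enorm_le _ (cvg_comp _ _ cvi cve)) => k; rewrite subr0.
  apply: penalized_distance_stationary => //; first exact/ltW/e0.
    exact: differentiable_partial.
  by move=> y'; exact: stat.
have lam0 : lam = 0.
  apply: (hnormal _ wD) => //.
  exists (tau \o chi), (fun k => (tau (chi k))^-1 *: (c (chi k) - z)), (zk \o chi).
  split=> //; first exact: (cvg_comp _ _ cvpsi cvz).
  (* Testing [stat] with y' = y removes the penalty and shows that [c] is a nearest point of C. *)
  move=> k; rewrite /= cE; apply: nearest_point_frechet_normal => // c' Cc'.
  by have := stat (chi k) (y (chi k)) c' Cc'; rewrite subrr enorm0 mulr0 addr0.
have lam1 : enorm lam = 1.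
  apply: (cvg_unique (@Rhausdorff R) (cvg_enorm cvz)); rewrite /=.
  by under eq_cvg do rewrite zk1; exact: cvg_cst.
by move/eqP: lam1; rewrite lam0 enorm0 eq_sym oner_eq0.
Qed.
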